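(* Let $(f_k)_{k\in\mathbb{N}}$, $(g_k)_{k\in\mathbb{N}}$ be sequences of proper, lower semicontinuous functions from $\mathbb{R}^n$ to $(-\infty,+\infty]$ which are eventually prox-bounded with threshold of eventual prox-boundedness $\bar\lambda>0$, and let $f,g:\mathbb{R}^n\to(-\infty,+\infty]$ be proper, lower semicontinuous and prox-bounded. Let $(\mu_k)_{k\in\mathbb{N}}$ be a sequence and $\mu$ a point in $(0,\bar\lambda)$, and let $(\alpha_k)_{k\in\mathbb{N}}$ be a sequence and $\alpha$ a point in $[0,1]$. Suppose that $f_k$ epi-converges to $f$, $g_k$ epi-converges to $g$, $\mu_k\to\mu$ and $\alpha_k\to\alpha$. Then $\varphi_{f_k,g_k,\alpha_k,\mu_k}$ epi-converges to $\varphi_{f,g,\alpha,\mu}$.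
   Context: $\|\cdot\|$ is the Euclidean norm. For a proper function $f$ and $\mu>0$, $e_{\mu}f(x)=\inf_{w}\{f(w)+\frac{1}{2\mu}\|w-x\|^2\}$. $f$ is prox-bounded if there exist $\lambda>0$ and $x$ with $e_{\lambda}f(x)>-\infty$. The proximal average is $\varphi_{f,g,\alpha,\mu}=-e_{\mu}(-\alpha e_{\mu}f-(1-\alpha)e_{\mu}g)$ (under the hypotheses the envelopes involved are finite for all sufficiently large $k$, which is all that matters for epi-convergence). A sequence $(f_k)$ is eventually prox-bounded if there exists $\lambda>0$ such that $\liminf_{k\to\infty}e_{\lambda}f_k(x)>-\infty$ for some $x$; the supremum of all such $\lambda$ is its threshold of eventual prox-boundedness. $(f_k)$ epi-converges to $f$ if for every $x\in\mathbb{R}^n$: (i) $f(x)\le\liminf_k f_k(x_k)$ for every sequence $x_k\to x$; (ii) there is a sequence $y_k\to x$ with $\limsup_k f_k(y_k)\le f(x)$. *)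

(* Defs.v *)
From HB Require Import structures.
From mathcomp Require Import all_boot all_order all_algebra.
From mathcomp Require Import all_classical all_reals all_analysis.

Set Implicit Arguments.
Unset Strict Implicit.
Unset Printing Implicit Defensive.

Import Order.TTheory GRing.Theory Num.Theory.
Import numFieldNormedType.Exports.

Local Open Scope classical_set_scope.
Local Open Scope ring_scope.

(* R^n is 'rV[R]_n. Its library topology is the product topology, which is the
   Euclidean one, but its library norm is the sup norm, so the Euclidean norm
   has to be introduced separately. *)
Definition enorm (R : realType) (n : nat) (x : 'rV[R]_n) : R :=
  Num.sqrt (\sum_(i < n) x ord0 i ^+ 2).

Section ProximalAverage.
Context {R : realType} {n : nat}.
Implicit Types (f g : 'rV[R]_n -> \bar R) (u : nat -> 'rV[R]_n -> \bar R).
Local Open Scope ereal_scope.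

(* Membership of the values in (-oo, +oo] is the first conjunct. *)
Definition proper_function f : Prop :=
  (forall x, -oo < f x) /\ (exists x, f x < +oo).

Definition moreau_envelope (mu : R) f : 'rV[R]_n -> \bar R := fun x =>
  ereal_inf (range (fun w => f w + ((2 * mu)^-1 * enorm (w - x) ^+ 2)%:E)).

Definition prox_bounded f : Prop :=
  exists2 l : R, (0 < l)%R & exists x, -oo < moreau_envelope l f x.

(* The envelope of a proper function is < +oo, so for 0 <= alpha <= 1 both
   summands below are > -oo and the sum is never of the form oo - oo. When an
   envelope is -oo and its weight is 0, the product is 0. *)
Definition proximal_average f g (alpha mu : R) : 'rV[R]_n -> \bar R := fun x =>
  - moreau_envelope mu
      (fun w => - (alpha%:E * moreau_envelope mu f w)
                - ((1 - alpha)%:E * moreau_envelope mu g w)) x.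

Definition eventual_prox_bound u (l : R) : Prop :=
  (0 < l)%R /\
  exists x, -oo < limn_einf (fun k => moreau_envelope l (u k) x).

Definition eventually_prox_bounded u : Prop := exists l, eventual_prox_bound u l.

Definition eventual_prox_threshold u : \bar R :=
  ereal_sup [set l%:E | l in [set l : R | eventual_prox_bound u l]].

Definition epi_converges u f : Prop :=
  forall x : 'rV[R]_n,
    (forall xs : nat -> 'rV[R]_n, xs @ \oo --> x ->
       f x <= limn_einf (fun k => u k (xs k))) /\
    (exists2 ys : nat -> 'rV[R]_n, ys @ \oo --> x &
       limn_esup (fun k => u k (ys k)) <= f x).

End ProximalAverage.

(* Main.v *)
Require Import Defs.
From HB Require Import structures.
From mathcomp Require Import all_boot all_order all_algebra.
From mathcomp Require Import all_classical all_reals all_analysis.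
From mathcomp Require Import ring lra.
Import Order.TTheory GRing.Theory Num.Theory.
Import numFieldNormedType.Exports.
Local Open Scope classical_set_scope.
Local Open Scope ring_scope.

(** With a = 1/(2 mu), the envelopes of f_k converge continuously to that of f:
    [e_{mu_k} f_k (y) -> e_mu f (x)] as (y, k) -> (x, oo).  The upper bound comes
    from recovery sequences; for the lower bound, eventual prox-boundedness at some
    l > mu confines the infimum to a fixed compact ball, on which the
    epi-lower limit is uniform by compactness.  Hence
    [H_k = - alpha_k e f_k - (1 - alpha_k) e g_k] converges continuously to a finite
    H, and the proximal average is [x |-> - inf_w (H_k w + a_k |w - x|^2)].  The
    liminf inequality follows from pointwise convergence of H_k.  For the limsup
    inequality at x, note that [H_k + a_k |. - x|^2] is convex (envelopes are
    infima of quadratics with the same leading term) and add a small multiple of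
    [|. - x|^2]: the minimiser u_k yields a point y_k near x at which the infimum
    defining the proximal average is attained at u_k, hence is controlled by the
    convergence of H_k on a compact ball. *)

(** * Euclidean inner product and quadratic growth *)

Definition dotv {R : realType} {n : nat} (v w : 'rV[R]_n) : R :=
  \sum_(i < n) v ord0 i * w ord0 i.

Section EuclideanStructure.
Context {R : realType} {n : nat}.
Implicit Types (t : R) (v w z x y : 'rV[R]_n).

Lemma dotvC v w : dotv v w = dotv w v.
Proof. by apply: eq_bigr => i _; rewrite mulrC. Qed.

Lemma dotvDl v w z : dotv (v + w) z = dotv v z + dotv w z.
Proof. by rewrite -big_split; apply: eq_bigr => i _; rewrite mxE mulrDl. Qed.

Lemma dotvZl t v w : dotv (t *: v) w = t * dotv v w.
Proof. by rewrite mulr_sumr; apply: eq_bigr => i _; rewrite mxE mulrA. Qed.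

Lemma dotvDr v w z : dotv v (w + z) = dotv v w + dotv v z.
Proof. by rewrite dotvC dotvDl !(dotvC v). Qed.

Lemma dotvZr t v w : dotv v (t *: w) = t * dotv v w.
Proof. by rewrite dotvC dotvZl dotvC. Qed.

Lemma dotvNl v w : dotv (- v) w = - dotv v w.
Proof. by rewrite -scaleN1r dotvZl mulN1r. Qed.

Lemma dotvNr v w : dotv v (- w) = - dotv v w.
Proof. by rewrite dotvC dotvNl dotvC. Qed.

Definition dotvE := (dotvDl, dotvDr, dotvZl, dotvZr, dotvNl, dotvNr).

Lemma dotv_ge0 v : 0 <= dotv v v.
Proof. by apply: sumr_ge0 => i _; rewrite -expr2 sqr_ge0. Qed.

Lemma enorm_sqr v : enorm v ^+ 2 = dotv v v.
Proof.
rewrite sqr_sqrtr; last by apply: sumr_ge0 => i _; exact: sqr_ge0.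
by apply: eq_bigr => i _; rewrite expr2.
Qed.

(** Here [|v|] is the sup norm: it is attained at one coordinate, whose square is a summand of
    [dotv v v]. Quadratic growth can thus be read off on balls of the library norm. *)
Lemma norm_sqr_le_dotv v : `|v| ^+ 2 <= dotv v v.
Proof.
have [v0|/mx_norm_neq0[[i j] /= vE]] := eqVneq (mx_norm v) 0.
  by rewrite (_ : `|v| = 0)// expr0n dotv_ge0.
rewrite (_ : `|v| = `|v i j|)// (ord1 i) real_normK ?num_real//.
by rewrite /dotv (bigD1 j)//= -expr2 lerDl sumr_ge0// => k _; rewrite -expr2 sqr_ge0.
Qed.

Lemma dotv_continuous : continuous (fun v : 'rV[R]_n => dotv v v).
Proof.
rewrite /dotv; apply: continuous_big => [|i _ v]; first exact: add_continuous.
by apply: continuousM; exact: coord_continuous.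
Qed.

Lemma dotvB_continuous x : continuous (fun w => dotv (w - x) (w - x)).
Proof.
move=> w; apply: (@continuous_comp _ _ _ (fun w => w - x) (fun v => dotv v v)).
  by apply: continuousB; [move=> ?; exact: cvg_id|exact: cst_continuous].
exact: dotv_continuous.
Qed.

(* Young's inequality absorbs the shift of the centre. *)
Lemma quadratic_growth (a b : R) x x0 : 0 <= b -> b < a ->
  exists2 k : R, 0 < k & exists C, \forall y \near x, forall w,
    k * dotv (w - x0) (w - x0) - C
      <= a * dotv (w - y) (w - y) - b * dotv (w - x0) (w - x0).
Proof.
move=> b0 ba; have a0 : 0 < a by exact: le_lt_trans ba.
(* Half of [a - b] is kept as growth rate; the other half absorbs the cross term, at the cost
   [a ^+ 2 / k * dotv u u], by completing a square. *)
pose k := (a - b) / 2; have k0 : 0 < k by rewrite divr_gt0 ?subr_gt0.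
exists k => //.
pose K := dotv (x - x0) (x - x0) + 1; exists (a ^+ 2 / k * K).
have : \forall y \near x, dotv (y - x0) (y - x0) < K.
  by apply: (cvgr_lt _ (@dotvB_continuous x0 x)); rewrite ltrDl.
apply: filterS => y yK w.
have -> : w - y = (w - x0) - (y - x0) by rewrite opprB addrA subrK.
move: (w - x0) (y - x0) yK => v u yK.
have -> : dotv (v - u) (v - u) = dotv v v - 2 * dotv v u + dotv u u.
  by rewrite !dotvE (dotvC u v); ring.
have := dotv_ge0 (k *: v - a *: u); have := dotv_ge0 u; have := dotv_ge0 v.
have -> : dotv (k *: v - a *: u) (k *: v - a *: u) =
   k * (k * dotv v v - 2 * a * dotv v u) + a ^+ 2 * dotv u u.
  by rewrite !dotvE (dotvC u v); ring.
set s := dotv v v; set d := dotv u u in yK *; set p := dotv v u => s0 d0 H.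
have H' : - (a ^+ 2 / k * d) <= k * s - 2 * a * p.
  rewrite -(ler_pM2l k0); have -> : k * - (a ^+ 2 / k * d) = - (a ^+ 2 * d).
    by field; rewrite gt_eqF.
  by lra.
have dK : a ^+ 2 / k * d <= a ^+ 2 / k * K.
  by rewrite ler_wpM2l ?ltW// divr_gt0 ?exprn_gt0.
have ad : 0 <= a * d by rewrite mulr_ge0// ltW.
have -> : a = 2 * k + b by rewrite /k; field.
rewrite {2}/k in H'.
have kE : 2 * k = a - b by rewrite /k; field.
nra.
Qed.

End EuclideanStructure.

(** * Upper and lower limits, and sequences versus neighbourhoods *)

Section SequenceLimits.
Context {R : realType}.
Implicit Types (u : nat -> \bar R) (c : \bar R).
Local Open Scope ereal_scope.

Lemma limn_esup_lt_near u c : limn_esup u < c -> \forall k \near \oo, u k < c.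
Proof.
rewrite /limn_esup limf_esupE => /ereal_inf_lt[_ [V Voo <-] supV].
apply: filterS Voo => k Vk; apply: le_lt_trans supV.
by apply: ereal_sup_ubound; exists k.
Qed.

Lemma limn_esup_le_near u c : (\forall k \near \oo, u k <= c) -> limn_esup u <= c.
Proof.
move=> uc; rewrite /limn_esup limf_esupE.
apply: ge_ereal_inf; exists (ereal_sup (u @` [set k | u k <= c])).
  by exists [set k | u k <= c].
by apply: ge_ereal_sup => _ [k ukc <-].
Qed.

Lemma lt_limn_einf_near u c : c < limn_einf u -> \forall k \near \oo, c < u k.
Proof.
rewrite /limn_einf lteNr => /limn_esup_lt_near.
by apply: filterS => k; rewrite /= lteN2.
Qed.

Lemma le_limn_einf_near u c : (\forall k \near \oo, c <= u k) -> c <= limn_einf u.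
Proof.
move=> uc; rewrite /limn_einf leeNr; apply: limn_esup_le_near.
by apply: filterS uc => k; rewrite leeN2.
Qed.

End SequenceLimits.

(* Points witnessing the failure along indices [N 0 < N 1 < ...], completed by
   the constant [x], form a sequence that converges to [x]. *)
Lemma near_prod_of_seq {R : realType} {V : normedModType R}
    (P : nat -> V -> Prop) (x : V) :
  (forall xs : nat -> V, xs @ \oo --> x -> \forall k \near \oo, P k (xs k)) ->
  \forall y \near x & k \near \oo, P k y.
Proof.
move=> Pseq; apply: contrapT => notP.
have bad (jN : nat * nat) : exists kw : nat * V,
    [/\ (jN.2 <= kw.1)%N, ball x jN.1.+1%:R^-1 kw.2 & ~ P kw.1 kw.2].
  apply: contrapT => nobad; apply: notP.
  exists (ball x jN.1.+1%:R^-1, [set k | (jN.2 <= k)%N]) => /=.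
    by split; [apply: nbhsx_ballx; rewrite invr_gt0|exists jN.2].
  move=> [w k] /= [xw Nk]; apply: contrapT => nP.
  by apply: nobad; exists (k, w).
have [B BP] := choice bad.
(* [B (j, M)] is a failure within [1 / (j + 1)] of [x] at an index at least [M]; taking [M] to be
   [(N i).+1] makes the indices strictly increasing. *)
pose N := fix N j := if j is i.+1 then (B (j, (N i).+1)).1 else (B (0%N, 0%N)).1.
pose W j := if j is i.+1 then (B (j, (N i).+1)).2 else (B (0%N, 0%N)).2.
have NW j : ball x j.+1%:R^-1 (W j) /\ ~ P (N j) (W j).
  by case: j => [|j]; [have [] := BP (0, 0)%N|have [] := BP (j.+1, (N j).+1)].
have Nlt j : (N j < N j.+1)%N by have [] := BP (j.+1, (N j).+1).
have Nmono : {mono N : i j / (i <= j)%N} by apply: leq_mono; apply: homo_ltn => //; exact: ltn_trans.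
have Nge j : (j <= N j)%N by elim: j => // j /leq_ltn_trans; apply.
pose xs k := if pselect (exists j, N j = k) is left ex then W (projT1 (cid ex)) else x.
have xsN j : xs (N j) = W j.
  rewrite /xs; case: pselect => [ex|[]]; last by exists j.
  by case: cid => i /= /(incn_inj Nmono) ->.
have xsx : xs @ \oo --> x.
  apply/cvg_ballP => e e0.
  have [M Me] : exists M, (M.+1%:R^-1 < e)%R.
    by have := near_infty_natSinv_lt (PosNum e0) => -[M _ /(_ M (leqnn _))] /=; exists M.
  exists (N M) => // k /= Mk; rewrite /xs.
  case: pselect => [ex|_]; last exact: ballxx.
  case: cid => i /= Nik; have [xWi _] := NW i.
  apply: le_ball xWi; apply: le_trans (ltW Me).
  by rewrite lef_pV2 ?posrE// ler_nat ltnS -Nmono Nik.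
have [M _ PM] := Pseq _ xsx.
by have := PM _ (Nge M); rewrite xsN; have [_] := NW M.
Qed.


(** * Infima with a quadratic penalty *)

Definition penalized_inf {R : realType} {n : nat} (a : R) (f : 'rV[R]_n -> \bar R)
    (x : 'rV[R]_n) : \bar R :=
  ereal_inf (range (fun w => f w + (a * dotv (w - x) (w - x))%:E)%E).

Lemma moreau_envelopeE {R : realType} {n : nat} (mu : R) (f : 'rV[R]_n -> \bar R) :
  moreau_envelope mu f = penalized_inf (2 * mu)^-1 f.
Proof.
apply/funext => x; congr (ereal_inf _).
by apply: eq_imagel => w _; rewrite enorm_sqr.
Qed.

Definition quadratically_minorized {R : realType} {n : nat} (b c : R) (x0 : 'rV[R]_n)
    (f : 'rV[R]_n -> \bar R) : Prop :=
  forall w, ((c - b * dotv (w - x0) (w - x0))%:E <= f w)%E.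

Lemma ereal_lt_between {R : realType} (c d : \bar R) :
  (c < d)%E -> exists m : R, (c < m%:E < d)%E.
Proof.
case: c d => [r| |] [s| |] //=.
- rewrite lte_fin => rs; exists ((r + s) / 2); rewrite !lte_fin; apply/andP; split; lra.
- by move=> _; exists (r + 1); rewrite ltry lte_fin ltrDl ltr01.
- by move=> _; exists (s - 1); rewrite ltNyr lte_fin ltrBlDr ltrDl ltr01.
- by move=> _; exists 0; rewrite ltNyr ltry.
Qed.

(** As [b < a], the penalty outgrows the minorant and bounds the infimum below; a point where [f] is
    finite bounds it above. *)
Lemma penalized_inf_fin_num {R : realType} {n : nat} (a b c : R) (x0 x : 'rV[R]_n)
    (f : 'rV[R]_n -> \bar R) :
  0 <= b -> b < a -> proper_function f -> quadratically_minorized b c x0 f ->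
  penalized_inf a f x \is a fin_num.
Proof.
move=> b0 ba [fNy [w fw]] fmin.
have [k k0 [C /nbhs_singleton kC]] := @quadratic_growth _ _ a b x x0 b0 ba.
rewrite fin_numElt; apply/andP; split.
  apply: (@lt_le_trans _ _ (c - C)%:E); first exact: ltNyr.
  apply: le_ereal_inf_tmp => _ [v _ <-].
  apply: le_trans (leeD2r _ (fmin v)); rewrite -EFinD lee_fin.
  have := kC v; have := mulr_ge0 (ltW k0) (dotv_ge0 (v - x0)); lra.
apply: (@le_lt_trans _ _ (f w + (a * dotv (w - x) (w - x))%:E)%E).
  by apply: ereal_inf_lbound; exists w.
by rewrite lte_add_pinfty ?ltry.
Qed.

Lemma cvg_dotvB {R : realType} {n : nat} {T : Type} (F : set_system T) {FF : Filter F}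
    (v w : T -> 'rV[R]_n) (x y : 'rV[R]_n) :
  v @ F --> x -> w @ F --> y ->
  (fun t => dotv (v t - w t) (v t - w t)) @ F --> dotv (x - y) (x - y).
Proof.
move=> vx wy.
apply: (@cvg_comp _ _ _ (fun t => v t - w t) (fun z : 'rV[R]_n => dotv z z)).
  exact: (cvgB vx wy).
exact: dotv_continuous.
Qed.

Lemma compact_closed_ball_ {R : realType} {n : nat} (x : 'rV[R]_n) (r : R) :
  compact [set w : 'rV[R]_n | `|x - w| <= r].
Proof.
apply: bounded_closed_compact; last exact: closed_closed_ball_.
exists (`|x| + r); split; first exact: num_real.
move=> M xM w /= xw; apply: le_trans (ltW xM).
have -> : w = x - (x - w) by rewrite opprB addrC subrK.
by apply: le_trans (ler_normB _ _) _; rewrite lerD2l.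
Qed.

(** * Joint convergence of envelopes in the centre and the index *)

Section EnvelopeConvergence.
Context {R : realType} {n : nat}.
Variables (fk : nat -> 'rV[R]_n -> \bar R) (f : 'rV[R]_n -> \bar R).
Variables (ak : nat -> R) (a b c : R) (x0 : 'rV[R]_n).
Hypotheses (b_ge0 : 0 <= b) (b_lt_a : b < a) (ak_cvg : ak @ \oo --> a).
Hypothesis fk_min : \forall k \near \oo, quadratically_minorized b c x0 (fk k).
Hypothesis fk_proper : forall k, proper_function (fk k).
Hypothesis fk_epi : epi_converges fk f.
Hypothesis f_proper : proper_function f.

(** The minorant is continuous, so it passes to the limit along a recovery sequence. *)
Lemma epi_limit_minorized : quadratically_minorized b c x0 f.
Proof.
move=> w; rewrite leNgt; apply/negP => /ereal_lt_between[m /andP[fm mlt]].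
have [_ [ys ysw /le_lt_trans/(_ fm)/limn_esup_lt_near fkm]] := fk_epi w.
have : c - b * dotv (w - x0) (w - x0) <= m.
  have lim : (fun k => c - b * dotv (ys k - x0) (ys k - x0)) @ \oo -->
      c - b * dotv (w - x0) (w - x0).
    apply: cvgB; first exact: cvg_cst.
    by apply: cvgMr; apply: cvg_dotvB => //; exact: cvg_cst.
  apply: (cvgr_to_le lim); near=> k.
  rewrite -lee_fin; apply: (@le_trans _ _ (fk k (ys k))).
    by move: (ys k); near: k.
  by apply: ltW; near: k.
by move: mlt; rewrite lte_fin leNgt => ->.
Unshelve. all: by end_near. Qed.

(** The sequential liminf inequality becomes a neighbourhood statement, the form that a compactness
    argument can use. *)
Lemma epi_lower_near (m : R) (w : 'rV[R]_n) : (m%:E < f w)%E ->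
  \forall v \near w & k \near \oo, (m%:E < fk k v)%E.
Proof.
move=> mf; apply: (@near_prod_of_seq _ _ (fun k v => m%:E < fk k v)%E) => xs xsw.
apply: lt_limn_einf_near; apply: lt_le_trans mf _.
by have [+ _] := fk_epi w; exact.
Qed.

Lemma cvg_penalty (w x : 'rV[R]_n) :
  (fun p : 'rV[R]_n * ('rV[R]_n * nat) => ak p.2.2 * dotv (p.1 - p.2.1) (p.1 - p.2.1))
    @ filter_prod (nbhs w) (filter_prod (nbhs x) \oo) --> a * dotv (w - x) (w - x).
Proof.
apply: cvgM.
  apply: (@cvg_comp _ _ _ (fun p : 'rV[R]_n * ('rV[R]_n * nat) => p.2.2) ak _ _ _ _ ak_cvg).
  by apply: (@cvg_comp _ _ _ snd snd) cvg_snd cvg_snd.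
apply: cvg_dotvB; first exact: cvg_fst.
by apply: (@cvg_comp _ _ _ snd fst) cvg_snd cvg_fst.
Qed.

Lemma penalized_inf_lower_near (m : R) (x : 'rV[R]_n) : (m%:E < penalized_inf a f x)%E ->
  \forall y \near x & k \near \oo, (m%:E <= penalized_inf (ak k) (fk k) y)%E.
Proof.
move=> mx.
(* Eventually [a' < ak j], so one growth constant [k] serves all large indices. *)
have [a' /andP[ba' a'a]] : exists a', b < a' < a.
  by exists ((b + a) / 2); rewrite !midf_lt.
have [k k0 [C kC]] := @quadratic_growth _ _ a' b x x0 b_ge0 ba'.
(* Since [1 <= r], any [s > r] has [s ^+ 2 >= r], and [k * r] dominates the absolute values of [m],
   [C] and [c] together. *)
pose r := 1 + (`|m| + `|C| + `|c|) / k.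
have r1 : 1 <= r by rewrite lerDl divr_ge0 ?addr_ge0// ltW.
have rP s : r < s -> m <= k * s ^+ 2 - C + c.
  move=> rs; have : k * r <= k * s ^+ 2.
    rewrite ler_pM2l//; nra.
  rewrite /r mulrDr mulr1 mulrCA divff ?gt_eqF// mulr1.
  have := ler_norm m; have := ler_norm C; have := ler_norm (- c); rewrite normrN; lra.
pose K := [set w : 'rV[R]_n | `|x0 - w| <= r].
have cK : compact K by exact: compact_closed_ball_.
have /compact_near_coveringP/(_ ('rV[R]_n * nat)%type (filter_prod (nbhs x) \oo)
  (fun i w => m%:E <= fk i.2 w + (ak i.2 * dotv (w - i.1) (w - i.1))%:E)%E _) := cK.
move=> cov.
have {}cov : \forall i \near filter_prod (nbhs x) \oo, K `<=` (fun w =>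
    m%:E <= fk i.2 w + (ak i.2 * dotv (w - i.1) (w - i.1))%:E)%E.
  apply: cov => w _.
  have : (m%:E < f w + (a * dotv (w - x) (w - x))%:E)%E.
    by apply: lt_le_trans mx _; apply: ereal_inf_lbound; exists w.
  (* The strict inequality is shared out: near [w], the function stays above [m2] and the penalty
     above [m - m2]. *)
  rewrite -lteBlDr// => /ereal_lt_between[m2 /andP[mm2 m2f]].
  have pen : \forall p \near filter_prod (nbhs w) (filter_prod (nbhs x) \oo),
      m - m2 < ak p.2.2 * dotv (p.1 - p.2.1) (p.1 - p.2.1).
    apply: (cvgr_gt _ (cvg_penalty w x)).
    by move: mm2; rewrite -EFinB lte_fin; lra.
  have low : \forall p \near filter_prod (nbhs w) (filter_prod (nbhs x) \oo),
      (m2%:E < fk p.2.2 p.1)%E.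
    have [[A B] /= [Aw Boo] AB] := epi_lower_near _ _ m2f.
    exists (A, setT `*` B) => /=.
      by split => //; exists (setT, B) => //=; split => //; exact: filterT.
    by move=> [v [y j]] /= [Av [_ Bj]]; exact: (AB (v, j)).
  near=> p; rewrite -leeBlDr// -EFinB.
  apply: (@le_trans _ _ m2%:E); last first.
    by apply: ltW; near: p; exact: low.
  rewrite lee_fin lerBlDl -lerBlDr; apply: ltW; near: p; exact: pen.
have out : \forall y \near x & j \near \oo, forall w, r < `|x0 - w| ->
    (m%:E <= fk j w + (ak j * dotv (w - y) (w - y))%:E)%E.
  exists ([set y | forall w,
      k * dotv (w - x0) (w - x0) - C
      <= a' * dotv (w - y) (w - y) - b * dotv (w - x0) (w - x0)],
    [set j | quadratically_minorized b c x0 (fk j) /\ a' < ak j]) => /=.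
    by split => //; apply: filterI => //; exact: (cvgr_gt _ ak_cvg).
  move=> [y j] /= [yC [jmin aj]] w rw.
  apply: le_trans (leeD2r _ (jmin w)); rewrite -EFinD lee_fin.
  have := rP _ rw; have := norm_sqr_le_dotv (w - x0); rewrite distrC => n1.
  have := yC w; have := dotv_ge0 (w - y).
  nra.
apply: filterS2 cov out => -[y j] /= inK outK.
apply: le_ereal_inf_tmp => _ [w _ <-].
by have [wr|wr] := leP `|x0 - w| r; [exact: inK|exact: outK].
Unshelve. all: by end_near. Qed.

(** A nearly optimal [w] for the centre [x] has a recovery sequence [ys], whose points serve as
    trial points for all centres [y] near [x]. *)
Lemma penalized_inf_upper_near (m : R) (x : 'rV[R]_n) : (penalized_inf a f x < m%:E)%E ->
  \forall y \near x & k \near \oo, (penalized_inf (ak k) (fk k) y < m%:E)%E.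
Proof.
move=> /ereal_inf_lt[_ [w _ <-]].
rewrite -lteBrDr// -EFinB => /ereal_lt_between[m2 /andP[fm2 m2m]].
have [_ [ys ysw /le_lt_trans/(_ fm2)/limn_esup_lt_near fkm]] := fk_epi w.
have pen : \forall p \near filter_prod (nbhs x) \oo,
    ak p.2 * dotv (ys p.2 - p.1) (ys p.2 - p.1) < m - m2.
  have lim : (fun p : 'rV[R]_n * nat => ak p.2 * dotv (ys p.2 - p.1) (ys p.2 - p.1))
      @ filter_prod (nbhs x) \oo --> a * dotv (w - x) (w - x).
    apply: cvgM; first by apply: (@cvg_comp _ _ _ snd ak) cvg_snd ak_cvg.
    apply: cvg_dotvB; last exact: cvg_fst.
    by apply: (@cvg_comp _ _ _ snd ys) cvg_snd ysw.
  by apply: (cvgr_lt _ lim); move: m2m; rewrite lte_fin; lra.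
have low : \forall p \near filter_prod (nbhs x) \oo, (fk p.2 (ys p.2) < m2%:E)%E.
  exists (setT, [set j | (fk j (ys j) < m2%:E)%E]) => /=.
    by split => //; exact: filterT.
  by move=> [y j] /= [_].
apply: filterS2 pen low => -[y j] /= pen low.
apply: le_lt_trans (_ : (fk j (ys j) + (ak j * dotv (ys j - y) (ys j - y))%:E < _)%E).
  by apply: ereal_inf_lbound; exists (ys j).
have -> : (m%:E = m2%:E + (m - m2)%:E)%E by rewrite -EFinD addrC subrK.
by apply: lteD => //; rewrite lte_fin.
Qed.

Lemma penalized_inf_near_fin_num :
  \forall k \near \oo, forall x, penalized_inf (ak k) (fk k) x \is a fin_num.
Proof.
have ab : \forall k \near \oo, b < ak k by exact: (cvgr_gt _ ak_cvg).
apply: filterS2 fk_min ab => k kmin bk x.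
exact: penalized_inf_fin_num kmin.
Qed.

Lemma penalized_inf_cvg (x : 'rV[R]_n) :
  (fun p : 'rV[R]_n * nat => fine (penalized_inf (ak p.2) (fk p.2) p.1))
    @ filter_prod (nbhs x) \oo --> fine (penalized_inf a f x).
Proof.
have fx : penalized_inf a f x \is a fin_num.
  exact: penalized_inf_fin_num epi_limit_minorized.
have fxE := fineK fx.
apply/cvgrPdist_le => e e0.
have up : (penalized_inf a f x < (fine (penalized_inf a f x) + e)%:E)%E.
  by rewrite -{1}fxE lte_fin ltrDl.
have low : ((fine (penalized_inf a f x) - e)%:E < penalized_inf a f x)%E.
  by rewrite -{2}fxE lte_fin ltrBlDr ltrDl.
apply: filterS2 (penalized_inf_upper_near _ _ up) (penalized_inf_lower_near _ _ low).
move=> [y j] /=; case: (penalized_inf (ak j) (fk j) y) => [s| |] //=.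
by rewrite lte_fin lee_fin => ? ?; rewrite ler_norml; apply/andP; split; lra.
Qed.

End EnvelopeConvergence.

(* Along a segment [w |-> a |v - w|^2] is quadratic with leading coefficient
   [a |w - u|^2], so an infimum of such functions is concave up to this term. *)
Lemma penalized_inf_semiconcave {R : realType} {n : nat} (a t : R)
    (f : 'rV[R]_n -> \bar R) (u w : 'rV[R]_n) :
  0 <= t <= 1 -> (forall v, -oo < f v)%E ->
  (forall x, penalized_inf a f x \is a fin_num) ->
  (1 - t) * fine (penalized_inf a f u) + t * fine (penalized_inf a f w)
    - a * (t * (1 - t)) * dotv (w - u) (w - u)
  <= fine (penalized_inf a f (u + t *: (w - u))).
Proof.
move=> /andP[t0 t1] fNy ffin.
rewrite -lee_fin fineK//; apply: le_ereal_inf_tmp => _ [v _ <-].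
have [fvy|fvy] := eqVneq (f v) +oo%E; first by rewrite fvy addye ?leey.
have fE : f v = (fine (f v))%:E.
  by rewrite fineK// fin_numElt fNy lt_neqAle fvy leey.
have E x : fine (penalized_inf a f x) <= fine (f v) + a * dotv (v - x) (v - x).
  by rewrite -lee_fin fineK// EFinD -fE; apply: ereal_inf_lbound; exists v.
rewrite fE -EFinD lee_fin.
have -> : v - (u + t *: (w - u)) = (v - u) - t *: (w - u) by rewrite opprD addrA.
have := E u; have := E w.
have -> : v - w = (v - u) - (w - u) by rewrite opprB addrA subrK.
move: (v - u) (w - u) => p q Ew Eu.
(* The weighted sum of the two bounds closes by the identity [(1 - t) |p|^2 + t |p - q|^2 - t (1 -
   t) |q|^2 = |p - t q|^2]. *)
have := ler_wpM2l t0 Ew.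
have := ler_wpM2l (_ : 0 <= 1 - t) Eu; rewrite subr_ge0 => /(_ t1).
by rewrite !dotvE (dotvC q p); lra.
Qed.

(** * Minimisation on a ball and recentring *)

Lemma ge0_of_affine_ge0 {R : realFieldType} (A B t0 : R) : 0 < t0 ->
  (forall t, 0 < t <= t0 -> 0 <= A + t * B) -> 0 <= A.
Proof.
move=> t00 AB; rewrite leNgt; apply/negP => A0.
pose t := Num.min t0 (- A / (2 * (`|B| + 1))).
have B1 : 0 < 2 * (`|B| + 1) by rewrite mulr_gt0// ltr_wpDl.
have t_gt0 : 0 < t by rewrite lt_min t00 divr_gt0// oppr_gt0.
have := AB t; rewrite t_gt0 ge_min lexx => /(_ isT).
have : t * (2 * (`|B| + 1)) <= - A by rewrite -ler_pdivlMr// ge_min lexx orbT.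
have : t * B <= t * `|B| by rewrite ler_pM2l// ler_norm.
lra.
Qed.

Lemma compact_uniform_lower_bound {R : realType} {V : topologicalType}
    (K : set V) (Q : nat -> V -> R) (Qoo : V -> R) (m : R) :
  compact K ->
  (forall x, (fun p : V * nat => Q p.2 p.1) @ filter_prod (nbhs x) \oo --> Qoo x) ->
  (forall x, m < Qoo x) ->
  \forall k \near \oo, forall x, K x -> m < Q k x.
Proof.
move=> /compact_near_coveringP/(_ nat \oo (fun k x => m < Q k x) _) cov Qcvg mQ.
apply: cov => x _; exact: (cvgr_gt _ (Qcvg x)).
Qed.

(* Minimise [Hk + ak |. - x|^2 + e |. - x|^2] on a large ball: the minimiser [u]
   is interior, so [- 2 e (u - x)] is a subgradient at [u] of the convex function
   [Hk + ak |. - x|^2]; moving the centre from [x] to [y = x - (e / ak) (u - x)]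
   makes [u] a global minimiser, and [e] times the radius is small. *)
Lemma recentered_lower_bound {R : realType} {n : nat}
    (Hk : nat -> 'rV[R]_n -> R) (H : 'rV[R]_n -> R) (ak : nat -> R) (a m d : R)
    (x : 'rV[R]_n) :
  0 < a -> ak @ \oo --> a -> 0 < d ->
  (\forall k \near \oo, continuous (Hk k)) ->
  (\forall k \near \oo, forall (u w : 'rV[R]_n) t, 0 <= t <= 1 ->
    Hk k (u + t *: (w - u)) <= (1 - t) * Hk k u + t * Hk k w
      + ak k * (t * (1 - t)) * dotv (w - u) (w - u)) ->
  (forall w, (fun p : 'rV[R]_n * nat => Hk p.2 p.1)
    @ filter_prod (nbhs w) \oo --> H w) ->
  (forall w, m <= H w + a * dotv (w - x) (w - x)) ->
  \forall k \near \oo, exists2 y, `|x - y| < d &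
    forall w, m - d <= Hk k w + ak k * dotv (w - y) (w - y).
Proof.
move=> a0 aka d0 Hcont Hconv Hcvg Hm.
pose Q k w := Hk k w + ak k * dotv (w - x) (w - x).
(* The bound [dl <= d] serves the conclusion; [dl <= 2^-1] serves to exclude minimisers on the
   sphere. *)
have [dl [dl0 dld dlh]] : exists dl, [/\ 0 < dl, dl <= d & dl <= 2^-1].
  by exists (Num.min d 2^-1); rewrite lt_min d0 invr_gt0 ltr0n !ge_min !lexx orbT.
(* The weight [e] and radius [r] solve [e * r ^+ 2 = M] and [e * r = eta]. The first makes the added
   term too costly on the sphere; the second, with [a / 2 < ak k], keeps the shift of the centre
   below [d]. *)
pose M := `|H x - m| + 2; have M0 : 0 < M by rewrite ltr_wpDl.
pose eta := a * d / 4; have eta0 : 0 < eta by rewrite divr_gt0 ?mulr_gt0.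
pose r := M / eta; have r0 : 0 < r by rewrite divr_gt0.
pose e := eta / r; have e0 : 0 < e by rewrite divr_gt0.
have er : e * r = eta by rewrite divfK// gt_eqF.
have err : e * r ^+ 2 = M by rewrite expr2 mulrA er mulrC divfK// gt_eqF.
pose K := [set w : 'rV[R]_n | `|x - w| <= r].
have Kx : K x by rewrite /K/= subrr normr0 ltW.
have cK : compact K by exact: compact_closed_ball_.
have Qlow : \forall k \near \oo, forall w, K w -> m - dl < Q k w.
  apply: (compact_uniform_lower_bound _ _ (fun w => H w + a * dotv (w - x) (w - x))) => // w.
    apply: cvgD; first exact: Hcvg.
    apply: cvgM; first by apply: (@cvg_comp _ _ _ snd ak) cvg_snd aka.
    by apply: cvg_dotvB; [exact: cvg_fst|exact: cvg_cst].
  by apply: lt_le_trans (Hm w); rewrite ltrBlDr ltrDl.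
have Qx : \forall k \near \oo, Hk k x < H x + 2^-1.
  have : \forall y \near x & k \near \oo, Hk k y < H x + 2^-1.
    by apply: (cvgr_lt _ (Hcvg x)); rewrite ltrDl invr_gt0.
  by move=> [[A B] /= [/nbhs_singleton Ax Boo] AB]; apply: filterS Boo => k Bk; exact: (AB (x, k)).
have ak_half : \forall k \near \oo, a / 2 < ak k.
  by apply: (cvgr_gt _ aka); rewrite ltr_pdivrMr// ltr_pMr// ltr1n.
near=> k.
have Qlowk : forall w, K w -> m - dl < Q k w by near: k.
have Qxk : Hk k x < H x + 2^-1 by near: k.
have akk : a / 2 < ak k by near: k.
have contk : continuous (Hk k) by near: k.
have convk : forall (u w : 'rV[R]_n) t, 0 <= t <= 1 ->
    Hk k (u + t *: (w - u)) <= (1 - t) * Hk k u + t * Hk k w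
      + ak k * (t * (1 - t)) * dotv (w - u) (w - u) by near: k.
have ak0 : 0 < ak k by apply: le_lt_trans akk; rewrite divr_ge0// ltW.
pose J w := Q k w + e * dotv (w - x) (w - x).
have cJ : continuous J.
  move=> w; have pen := @dotvB_continuous R n x w.
  exact: (cvgD (cvgD (contk w) (cvgM (cvg_cst _) pen)) (cvgM (cvg_cst _) pen)).
have [u] := @EVT_min_rV R n J K (ex_intro _ x Kx) cK (continuous_subspaceT cJ).
rewrite inE => Ku Jmin.
have Jx : J u < H x + 2^-1.
  apply: le_lt_trans (Jmin x _) _; first by rewrite inE.
  by rewrite /J /Q subrr -(scale0r 0) dotvZl !(mul0r, mulr0, addr0).
(* On the sphere [J u] would exceed [m - dl + M >= H x + 3/2], against [Jx]. *)
have ur : `|x - u| < r.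
  rewrite lt_neqAle Ku andbT; apply/eqP => xur.
  have := norm_sqr_le_dotv (u - x); rewrite distrC xur -(ler_pM2l e0) err.
  have := Qlowk _ Ku; move: Jx; rewrite /J /M; have := ler_norm (H x - m); lra.
(* Compare [u] with [u + t *: (w - u)], which stays in [K] for [t <= t0] because [u] is interior.
   [Q k] is convex on the segment, so division by [t] leaves the claim plus a term linear in [t],
   which vanishes as [t] tends to 0. *)
have subgrad w : Q k u - 2 * e * dotv (u - x) (w - u) <= Q k w.
  rewrite -subr_ge0.
  pose t0 := Num.min 1 ((r - `|x - u|) / (1 + `|w - u|)).
  have w1 : 0 < 1 + `|w - u| by rewrite ltr_pwDl.
  have t00 : 0 < t0 by rewrite lt_min ltr01 divr_gt0// subr_gt0.
  apply: (@ge0_of_affine_ge0 _ _ (e * dotv (w - u) (w - u)) t0) => // t /andP[t_gt0 tt0].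
  have t1 : t <= 1 by apply: le_trans tt0 _; rewrite ge_min lexx.
  have tr : t * (1 + `|w - u|) <= r - `|x - u|.
    by rewrite -ler_pdivlMr//; apply: le_trans tt0 _; rewrite ge_min lexx orbT.
  have Kt : K (u + t *: (w - u)).
    rewrite /K/= opprD addrA; apply: le_trans (ler_normB _ _) _.
    by rewrite normrZ gtr0_norm//; lra.
  have := Jmin (u + t *: (w - u)); rewrite inE => /(_ Kt).
  have := convk u w t; rewrite (ltW t_gt0) t1 => /(_ isT).
  rewrite /J /Q.
  have -> : u + t *: (w - u) - x = (u - x) + t *: (w - u) by rewrite addrAC.
  have -> : w - x = (u - x) + (w - u) by rewrite [RHS]addrC addrA subrK.
  move: (Hk k _) => h; move: (Hk k u) (Hk k w) (u - x) (w - u) => hu hw s v.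
  rewrite !dotvE !(dotvC v s) => C1 C2.
  rewrite -(pmulr_rge0 _ t_gt0); lra.
exists (x - (e / ak k) *: (u - x)).
  rewrite opprB addrC subrK normrZ (gtr0_norm (divr_gt0 e0 ak0)).
  rewrite distrC mulrAC ltr_pdivrMr//; apply: (@le_lt_trans _ _ eta).
    by rewrite -er ler_pM2l// ltW.
  have := mulr_gt0 a0 d0; have : d * (a / 2) < d * ak k by rewrite ltr_pM2l.
  by rewrite /eta; lra.
move=> w.
(* The new centre adds [2 * e * dotv (u - x) (w - x)] and a constant to [Q k w]. This cancels the
   linear term of [subgrad], leaving [Q k u] plus nonnegative multiples of
   [dotv (u - x) (u - x)]. *)
have Qu := Qlowk _ Ku; have := subgrad w; rewrite {2}/Q.
have -> : w - (x - (e / ak k) *: (u - x)) = (w - x) + (e / ak k) *: (u - x).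
  by rewrite opprB addrCA addrC.
have -> : w - x = (u - x) + (w - u) by rewrite [RHS]addrC addrA subrK.
move: (Hk k w) (u - x) (w - u) => h s v sub.
have s0 := dotv_ge0 s.
set th := e / ak k.
have eE : e = ak k * th by rewrite /th mulrC divfK// gt_eqF.
have th0 : 0 < th by exact: divr_gt0.
have akth : 0 < ak k * th by exact: mulr_gt0.
have S1 := mulr_ge0 (ltW akth) s0.
have S2 := mulr_ge0 (ltW (mulr_gt0 akth th0)) s0.
move: sub; rewrite eE !dotvE !(dotvC v s); lra.
Unshelve. all: by end_near. Qed.

(** * Recovery sequences and passage to Moreau envelopes *)

(** One sequence must serve every tolerance [d]. At index [k] the point is taken for a tolerance
    within [1 / (k + 1)] of the infimum of the admissible ones. *)
Lemma recovery_sequence {R : realType} {V : normedModType R}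
    (phi : nat -> V -> \bar R) (x : V) (v : R) :
  (forall d, 0 < d -> \forall k \near \oo,
    exists2 y, `|x - y| < d & (phi k y <= (v + d)%:E)%E) ->
  exists2 ys : nat -> V, ys @ \oo --> x &
    (limn_esup (fun k => phi k (ys k)) <= v%:E)%E.
Proof.
move=> near_rec.
pose S k := [set d : R | exists2 y, `|x - y| < d & (phi k y <= (v + d)%:E)%E].
have /choice[ys ysP] k : exists y, forall d e, S k d -> d + k.+1%:R^-1 <= e ->
    `|x - y| < e /\ (phi k y <= (v + e)%:E)%E.
  have [[d0 Sd0]|S0] := pselect (S k !=set0); last first.
    (* With no admissible tolerance at [k], the default [x] satisfies the claim vacuously. *)
    by exists x => d e Sd; case: S0; exists d.
  have infS : has_inf (S k).
    by split; [exists d0|exists 0 => d [y xy _]; exact: le_trans (ltW xy)].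
  have k0 : 0 < k.+1%:R^-1 :> R by rewrite invr_gt0.
  have [d1 [y xy phiy] d1inf] := inf_adherent k0 infS.
  exists y => d e Sd de.
  have infd : inf (S k) <= d by apply: ge_inf => //; have [] := infS.
  have d1e : d1 < e.
    by apply: lt_le_trans d1inf _; apply: le_trans de; rewrite lerD2r.
  split; first exact: lt_trans d1e.
  by apply: le_trans phiy _; rewrite lee_fin lerD2l ltW.
have ys_near e : 0 < e -> \forall k \near \oo,
    `|x - ys k| < e /\ (phi k (ys k) <= (v + e)%:E)%E.
  move=> e0; have e20 : 0 < e / 2 by rewrite divr_gt0.
  have inv_small : \forall k \near \oo, k.+1%:R^-1 < e / 2.
    exact: (near_infty_natSinv_lt (PosNum e20)).
  apply: filterS2 (near_rec _ e20) inv_small => k Sk ke.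
  by apply: (ysP k (e / 2)) => //; rewrite [leRHS]splitr lerD2l ltW.
exists ys.
  by apply/cvgrPdist_lt => e /ys_near; apply: filterS => k [].
apply/lee_addgt0Pr => e /ys_near near_e; rewrite -EFinD.
by apply: limn_esup_le_near; apply: filterS near_e => k [].
Qed.

(** Through the constant sequence, joint convergence yields continuity of the envelope of a single
    function. *)
Lemma epi_converges_cst {R : realType} {n : nat} (f : 'rV[R]_n -> \bar R) :
  lower_semicontinuous f -> epi_converges (fun=> f) f.
Proof.
move=> flsc x; split; last first.
  exists (fun=> x); first exact: cvg_cst.
  by apply: limn_esup_le_near; exact: nearW.
move=> xs xsx; rewrite leNgt; apply/negP => /ereal_lt_between[m /andP[lim_m mf]].
have [U Ux Uf] := flsc _ _ mf.
suff : (m%:E <= limn_einf (fun k => f (xs k)))%E by rewrite leNgt lim_m.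
have xsU : \forall k \near \oo, U (xs k) := xsx _ Ux.
by apply: le_limn_einf_near; apply: filterS xsU => k Uk; exact/ltW/Uf.
Qed.

Lemma cvg_fst_filter_prod {R : realType} {T : Type} {G : set_system T} {FG : Filter G}
    (g : T -> R) (l : R) :
  (fun p : T * nat => g p.1) @ filter_prod G \oo --> l -> g @ G --> l.
Proof.
move=> gl A /gl[[B C] /= [GB [k _ kC]] BC].
suff : G (g @^-1` A) by [].
by apply: filterS GB => y By; exact: (BC (y, k) (conj By (kC k (leqnn k)))).
Qed.

(** Some admissible [l] exceeds [mu], and a lower bound [c] on the envelope with parameter [l] at
    [x0] unfolds to a minorant with coefficient [(2 * l)^-1]. *)
Lemma eventual_minorant {R : realType} {n : nat} (u : nat -> 'rV[R]_n -> \bar R) (mu : R) :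
  0 < mu -> (mu%:E < eventual_prox_threshold u)%E ->
  exists b c x0, [/\ 0 <= b, b < (2 * mu)^-1 &
    \forall k \near \oo, quadratically_minorized b c x0 (u k)].
Proof.
move=> mu0 /ereal_sup_gt[_ [l [l0 [x0 liminf_l]] <-]]; rewrite lte_fin => mul.
have [c /andP[_ cl]] := ereal_lt_between _ _ liminf_l.
exists (2 * l)^-1, c, x0; split.
- by rewrite invr_ge0 mulr_ge0// ltW.
- by rewrite ltf_pV2 ?posrE ?mulr_gt0// ltr_pM2l.
apply: filterS (lt_limn_einf_near _ _ cl) => k; rewrite moreau_envelopeE => ck w.
rewrite EFinB leeBlDr//; apply: (le_trans (ltW ck)).
by apply: ereal_inf_lbound; exists w.
Qed.

Lemma moreau_envelope_cvg {R : realType} {n : nat} (fk : nat -> 'rV[R]_n -> \bar R)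
    (f : 'rV[R]_n -> \bar R) (muk : nat -> R) (mu : R) :
  0 < mu -> muk @ \oo --> mu -> (mu%:E < eventual_prox_threshold fk)%E ->
  (forall k, proper_function (fk k)) -> (forall k, lower_semicontinuous (fk k)) ->
  proper_function f -> epi_converges fk f ->
  let E k x := fine (moreau_envelope (muk k) (fk k) x) in
  [/\ forall x, moreau_envelope mu f x \is a fin_num,
      forall x, (fun p : 'rV[R]_n * nat => E p.2 p.1) @ filter_prod (nbhs x) \oo
        --> fine (moreau_envelope mu f x),
      \forall k \near \oo, forall x, moreau_envelope (muk k) (fk k) x \is a fin_num &
      \forall k \near \oo, continuous (E k)].
Proof.
move=> mu0 muk_cvg mu_lt fk_proper fk_lsc f_proper fk_epi E.
have [b [c [x0 [b0 ba fk_min]]]] := eventual_minorant _ _ mu0 mu_lt.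
have ak_cvg : (fun k => (2 * muk k)^-1) @ \oo --> (2 * mu)^-1.
  apply: cvgV; first by rewrite gt_eqF// mulr_gt0.
  exact: cvgMr.
have EE k x : E k x = fine (penalized_inf (2 * muk k)^-1 (fk k) x).
  by rewrite /E moreau_envelopeE.
split.
- move=> x; rewrite moreau_envelopeE; apply: (penalized_inf_fin_num _ _ _ _ _ _ b0 ba f_proper).
  exact: epi_limit_minorized _ _ _ _ _ fk_min fk_epi.
- move=> x; rewrite moreau_envelopeE; under eq_fun do rewrite EE.
  exact: (penalized_inf_cvg _ _ _ _ _ _ _ b0 ba ak_cvg fk_min).
- have := penalized_inf_near_fin_num _ _ _ _ _ _ b0 ba ak_cvg fk_min fk_proper.
  by apply: filterS => k kfin x; rewrite moreau_envelopeE.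
have ab : \forall k \near \oo, b < (2 * muk k)^-1 by exact: (cvgr_gt _ ak_cvg).
apply: filterS2 fk_min ab => k kmin bk x.
have -> : E k = fun y => fine (penalized_inf (2 * muk k)^-1 (fk k) y).
  by apply/funext => y; exact: EE.
apply: (@cvg_fst_filter_prod _ _ (nbhs x) _).
have a_cst : (fun _ : nat => (2 * muk k)^-1) @ \oo --> (2 * muk k)^-1.
  exact: cvg_cst.
have kmin_near : \forall j \near \oo, quadratically_minorized b c x0 (fk k).
  exact: nearW.
exact: (penalized_inf_cvg (fun=> fk k) (fk k) (fun=> (2 * muk k)^-1) _ b c x0 b0 bk
  a_cst kmin_near (epi_converges_cst _ (fk_lsc k))
  (fk_proper k) x).
Qed.

Lemma proximal_averageE {R : realType} {n : nat} (f g : 'rV[R]_n -> \bar R) (alpha mu : R) :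
  (forall x, moreau_envelope mu f x \is a fin_num) ->
  (forall x, moreau_envelope mu g x \is a fin_num) ->
  proximal_average f g alpha mu = fun x => (- penalized_inf (2 * mu)^-1 (fun w =>
    (- (alpha * fine (moreau_envelope mu f w))
     - (1 - alpha) * fine (moreau_envelope mu g w))%:E) x)%E.
Proof.
move=> ffin gfin; apply/funext => x; rewrite /proximal_average moreau_envelopeE.
congr (- penalized_inf _ _ _)%E; apply/funext => w.
by rewrite -{1}(fineK (ffin w)) -{1}(fineK (gfin w)).
Qed.

(** * Epi-convergence of the proximal averages *)

Theorem theorem6p9 (R : realType) (n : nat)
  (fk gk : nat -> 'rV[R]_n -> \bar R) (f g : 'rV[R]_n -> \bar R)
  (lbar : \bar R) (muk : nat -> R) (mu : R) (alphak : nat -> R) (alpha : R)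
  (fk_proper : forall k, proper_function (fk k))
  (fk_lsc : forall k, lower_semicontinuous (fk k))
  (gk_proper : forall k, proper_function (gk k))
  (gk_lsc : forall k, lower_semicontinuous (gk k))
  (fk_epb : eventually_prox_bounded fk)
  (gk_epb : eventually_prox_bounded gk)
  (fk_threshold : eventual_prox_threshold fk = lbar)
  (gk_threshold : eventual_prox_threshold gk = lbar)
  (lbar_gt0 : (0 < lbar)%E)
  (f_proper : proper_function f) (f_lsc : lower_semicontinuous f)
  (f_pb : prox_bounded f)
  (g_proper : proper_function g) (g_lsc : lower_semicontinuous g)
  (g_pb : prox_bounded g)
  (muk_itv : forall k, 0 < muk k /\ ((muk k)%:E < lbar)%E)
  (mu_itv : 0 < mu /\ (mu%:E < lbar)%E)
  (alphak_itv : forall k, 0 <= alphak k <= 1)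
  (alpha_itv : 0 <= alpha <= 1)
  (fk_epi : epi_converges fk f)
  (gk_epi : epi_converges gk g)
  (muk_cvg : muk @ \oo --> mu)
  (alphak_cvg : alphak @ \oo --> alpha) :
  epi_converges (fun k => proximal_average (fk k) (gk k) (alphak k) (muk k))
    (proximal_average f g alpha mu).
Proof.
have [mu0 mul] := mu_itv.
have f_lt : (mu%:E < eventual_prox_threshold fk)%E by rewrite fk_threshold.
have g_lt : (mu%:E < eventual_prox_threshold gk)%E by rewrite gk_threshold.
have [f_fin fk_cvg fk_fin fk_cont] :=
  moreau_envelope_cvg _ _ _ _ mu0 muk_cvg f_lt fk_proper fk_lsc f_proper fk_epi.
have [g_fin gk_cvg gk_fin gk_cont] :=
  moreau_envelope_cvg _ _ _ _ mu0 muk_cvg g_lt gk_proper gk_lsc g_proper gk_epi.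
pose a := (2 * mu)^-1; pose ak k := (2 * muk k)^-1.
have a0 : 0 < a by rewrite invr_gt0 mulr_gt0.
have ak_cvg : ak @ \oo --> a.
  by apply: cvgV; [rewrite gt_eqF// mulr_gt0|exact: cvgMr].
pose H w := - (alpha * fine (moreau_envelope mu f w))
  - (1 - alpha) * fine (moreau_envelope mu g w).
pose Hk k w := - (alphak k * fine (moreau_envelope (muk k) (fk k) w))
  - (1 - alphak k) * fine (moreau_envelope (muk k) (gk k) w).
have phiE : proximal_average f g alpha mu =
    fun x => (- penalized_inf a (fun w => (H w)%:E) x)%E by exact: proximal_averageE.
have phikE : \forall k \near \oo, proximal_average (fk k) (gk k) (alphak k) (muk k) =
    fun x => (- penalized_inf (ak k) (fun w => (Hk k w)%:E) x)%E.
  by apply: filterS2 fk_fin gk_fin => k ? ?; exact: proximal_averageE.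
have Hcvg w : (fun p : 'rV[R]_n * nat => Hk p.2 p.1)
    @ filter_prod (nbhs w) \oo --> H w.
  have al : (fun p : 'rV[R]_n * nat => alphak p.2)
      @ filter_prod (nbhs w) \oo --> alpha.
    by apply: (@cvg_comp _ _ _ snd alphak) cvg_snd alphak_cvg.
  by apply: cvgB; [apply: cvgN; apply: cvgM|apply: cvgM => //; apply: cvgB => //; exact: cvg_cst].
have Hcont : \forall k \near \oo, continuous (Hk k).
  apply: filterS2 fk_cont gk_cont => k fc gc w.
  exact: (cvgB (cvgN (cvgM (cvg_cst _) (fc w))) (cvgM (cvg_cst _) (gc w))).
(* Both envelopes carry the same coefficient [ak k] and the weights sum to 1, so the two quadratic
   corrections add up to a single one. *)
have Hconv : \forall k \near \oo, forall (u w : 'rV[R]_n) t, 0 <= t <= 1 ->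
    Hk k (u + t *: (w - u)) <= (1 - t) * Hk k u + t * Hk k w
      + ak k * (t * (1 - t)) * dotv (w - u) (w - u).
  apply: filterS2 fk_fin gk_fin => k ffin gfin u w t t01.
  have fsc := @penalized_inf_semiconcave _ _ (ak k) t (fk k) u w t01 (proj1 (fk_proper k)).
  have gsc := @penalized_inf_semiconcave _ _ (ak k) t (gk k) u w t01 (proj1 (gk_proper k)).
  rewrite -!moreau_envelopeE in fsc gsc.
  have /andP[al0 al1] := alphak_itv k.
  have := ler_wpM2l al0 (fsc ffin).
  have := ler_wpM2l (_ : 0 <= 1 - alphak k) (gsc gfin); rewrite subr_ge0 => /(_ al1).
  rewrite /Hk; lra.
move=> x; rewrite phiE; split.
  (* Because of the outer minus sign, one nearly optimal [w] for the limit, kept fixed in [k], is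
     enough for the liminf inequality. *)
  move=> xs xsx; rewrite leNgt; apply/negP => /ereal_lt_between[m /andP[lim_m]].
  rewrite lteNr => /ereal_inf_lt[_ [w _ <-]]; rewrite -EFinD -EFinN lte_fin => wm.
  suff : (m%:E <= limn_einf (fun k =>
      proximal_average (fk k) (gk k) (alphak k) (muk k) (xs k)))%E.
    by rewrite leNgt lim_m.
  have Hw : (fun k => Hk k w + ak k * dotv (w - xs k) (w - xs k)) @ \oo
      --> H w + a * dotv (w - x) (w - x).
    have pairs : (fun k => (w, k)) @ \oo --> filter_prod (nbhs w) \oo.
      move=> A [[B C] /= [/nbhs_singleton Bw Coo] BC].
      by apply: (filterS _ Coo) => k Ck; exact: (BC (w, k) (conj Bw Ck)).
    have pen : (fun k => dotv (w - xs k) (w - xs k)) @ \oo --> dotv (w - x) (w - x).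
      by apply: cvg_dotvB => //; exact: cvg_cst.
    apply: cvgD (cvgM ak_cvg pen).
    exact: (@cvg_comp _ _ _ (fun k => (w, k)) (fun p => Hk p.2 p.1) _ _ _ pairs (Hcvg w)).
  apply: le_limn_einf_near.
  apply: filterS2 phikE (cvgr_lt _ Hw _ wm) => k -> Hkw.
  rewrite leeNr; apply: le_trans (_ : (Hk k w + ak k * dotv (w - xs k) (w - xs k))%:E <= _)%E.
    by apply: ereal_inf_lbound; exists w.
  by rewrite -EFinN lee_fin ltW.
(* If the infimum is [-oo], the proximal average at [x] is [+oo] and the constant sequence is a
   recovery sequence. *)
have [phi_oo|phi_fin] := eqVneq (penalized_inf a (fun w => (H w)%:E) x) -oo%E.
  by exists (fun=> x); [exact: cvg_cst|rewrite phi_oo leey].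
have phi_lty : (penalized_inf a (fun w => (H w)%:E) x < +oo)%E.
  apply: (@le_lt_trans _ _ (H x + a * dotv (x - x) (x - x))%:E); last exact: ltry.
  by apply: ereal_inf_lbound; exists x.
have [m mE] : exists m, penalized_inf a (fun w => (H w)%:E) x = m%:E.
  by case: penalized_inf phi_fin phi_lty => // m _ _; exists m.
have Hm w : m <= H w + a * dotv (w - x) (w - x).
  by rewrite -lee_fin -mE; apply: ereal_inf_lbound; exists w.
rewrite mE -EFinN; 
apply: (recovery_sequence (fun k => proximal_average (fk k) (gk k) (alphak k) (muk k))) => d d0.
(* After the sign change, the lower bound [m - d] at the centre [y] is the upper bound [- m + d] on
   the proximal average there. *)
have := recentered_lower_bound _ _ _ _ _ _ _ a0 ak_cvg d0 Hcont Hconv Hcvg Hm.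
apply: filterS2 phikE => k -> [y xy ylow]; exists y => //.
rewrite leeNl -EFinN opprD opprK; apply: le_ereal_inf_tmp => _ [w _ <-].
by rewrite -EFinD lee_fin.
Qed.
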